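(* Let $\alpha\vDash n$ be a peak composition. Then the $HCl_n(0)$-supermodule $\widetilde{\mathbf{N}}_{\mathsf{SPCT}(\alpha)}$ is tableau-cyclic, generated by the source tableau $T_\alpha^{\sup}\in\mathsf{SPCT}(\alpha)$.
   Context: A composition $\alpha=(\alpha_1,\dots,\alpha_k)\vDash n$ is a sequence of positive integers with sum $n$; $\ell(\alpha)=k$. A peak composition is a composition all of whose parts, except possibly the last, are greater than $1$. $[m]=\{1,\dots,m\}$. Algebras. $H_n(0)$ is the $\mathbb{C}$-algebra with generators $\pi_1,\dots,\pi_{n-1}$ and relations $\pi_i^2=-\pi_i$, $\pi_i\pi_j=\pi_j\pi_i$ for $|i-j|\ge2$, $\pi_i\pi_{i+1}\pi_i=\pi_{i+1}\pi_i\pi_{i+1}$. $HCl_n(0)$ is generated by $\pi_1,\dots,\pi_{n-1}$ (with these relations) and $c_1,\dots,c_n$ with $c_i^2=-1$, $c_ic_j=-c_jc_i$ for $i\ne j$, and $\pi_ic_j=c_j\pi_i$ for $j\ne i,i+1$, $\pi_ic_i=c_{i+1}\pi_i$, $(\pi_i+1)c_{i+1}=c_i(\pi_i+1)$. It is a superalgebra with $\pi_i$ of degree $0$, $c_j$ of degree $1$. Diagram modules. Let $D$ be a diagram of $n$ boxes with a reading order (a total order on the boxes). A standard filling is a bijective assignment of $1,\dots,n$ to the boxes; $\mathrm{rw}(T)$ is the permutation given by the entries of $T$ in reading order from left to right; $s_iT$ exchanges the entries $i,i+1$ of $T$. For a nonempty set $\mathcal{T}$ of standard fillings and $T\in\mathcal{T}$,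 $\mathrm{Des}(T)$ is the set of $i\in[n-1]$ with $i$ to the right of $i+1$ in $\mathrm{rw}(T)$. Elements of $[n-1]\setminus\mathrm{Des}(T)$ are ascents; an ascent $i$ is attacking if $s_iT\notin\mathcal{T}$ and nonattacking otherwise. $T$ has an ascent in positions $(r,s)$ if $r<s$ and $\mathrm{rw}(T)_s-\mathrm{rw}(T)_r=1$. $\mathcal{T}$ is ascent-compatible if whenever $T,T'\in\mathcal{T}$ both have an ascent in positions $(r,s)$, it is attacking in $T$ if and only if it is attacking in $T'$. In that case $\mathbf{N}_{\mathcal{T}}$ is the $H_n(0)$-module on the $\mathbb{C}$-span of $\mathcal{T}$ with $\pi_iT=-T$ if $i\in\mathrm{Des}(T)$, $0$ if $i$ is an attacking ascent, $s_iT$ if $i$ is a nonattacking ascent; and $\widetilde{\mathbf{N}}_{\mathcal{T}}=\mathrm{Ind}_{H_n(0)}^{HCl_n(0)}\mathbf{N}_{\mathcal{T}}$, which has basis $\{c_XT:X\subseteq[n],T\in\mathcal{T}\}$ where $c_X=c_{i_1}\cdots c_{i_k}$ for $X=\{i_1<\cdots<i_k\}$; $T$ is identified with $c_\emptyset T$. $\widetilde{\mathbf{N}}_{\mathcal{T}}$ is tableau-cyclic if it is generated (as an $HCl_n(0)$-module) by a single $T\in\mathcal{T}$. Tableaux. $D(\alpha)$ is the left-justified array with $\alpha_i$ boxes in row $i$, rows numbered from bottom to top. For a peak composition $\alpha\vDash n$, $\mathsf{SPCT}(\alpha)$ is the set of standard fillings of $D(\alpha)$ such that: (SPCT1) entries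 increase from left to right along each row; (SPCT2) entries increase from bottom to top in the first column; (SPCT3) for every $1\le k\le n$, the boxes with entries at most $k$ form the diagram of a peak composition. The reading order reads columns from bottom to top, starting with the leftmost column and proceeding rightwards. $\mathsf{SPCT}(\alpha)$ is ascent-compatible for this reading order. The source tableau $T_\alpha^{\sup}\in\mathsf{SPCT}(\alpha)$ is the tableau whose entries in column $1$ are the first $\ell(\alpha)$ odd numbers, whose entries in column $2$ are the first $\ell(\alpha)-1$ even numbers if the last part of $\alpha$ equals $1$ and the first $\ell(\alpha)$ even numbers otherwise, and whose entries in the subsequent columns (taken from left to right) are the remaining numbers, increasing consecutively up each column. E.g. for $\alpha=(3,4,3,2)$ the rows from bottom to top are $1,2,9$; $3,4,10,12$; $5,6,11$; $7,8$. *)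

(* Defs.v *)
From HB Require Import structures.
From mathcomp Require Import all_boot all_order all_algebra all_fingroup.
From mathcomp Require Import generic_quotient.
From mathcomp Require Import boolp zify.
Set Implicit Arguments. Unset Strict Implicit. Unset Printing Implicit Defensive.
Import GRing.Theory.
Local Open Scope ring_scope.
Local Open Scope quotient_scope.

(* Algebras given by generators and relations.  The quotient of the terms by
   the least congruence containing the axioms of unital associative F-algebras
   and the relations [rel].  Nothing guarantees 1 != 0 for an arbitrary [rel],
   so the result is a pzRingType which is also an lmodType F, with scalars
   commuting with products; nzRingType (hence algType) is out of reach here. *)

Section PresentedAlgebra.
Variables (F : fieldType) (I : Type).

Inductive aexp : Type :=
  | AGen of I
  | AScal of F
  | AAdd of aexp & aexp
  | AMul of aexp & aexp.

Variable rel : aexp -> aexp -> Prop.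

Inductive acong : aexp -> aexp -> Prop :=
  | acong_rel x y : rel x y -> acong x y
  | acong_refl x : acong x x
  | acong_sym x y : acong x y -> acong y x
  | acong_trans x y z : acong x y -> acong y z -> acong x z
  | acong_add x x' y y' :
      acong x x' -> acong y y' -> acong (AAdd x y) (AAdd x' y')
  | acong_mul x x' y y' :
      acong x x' -> acong y y' -> acong (AMul x y) (AMul x' y')
  | acong_addA x y z : acong (AAdd x (AAdd y z)) (AAdd (AAdd x y) z)
  | acong_addC x y : acong (AAdd x y) (AAdd y x)
  | acong_add0 x : acong (AAdd (AScal 0) x) x
  | acong_addN x : acong (AAdd (AMul (AScal (-1)) x) x) (AScal 0)
  | acong_mulA x y z : acong (AMul x (AMul y z)) (AMul (AMul x y) z)
  | acong_mul1l x : acong (AMul (AScal 1) x) x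
  | acong_mul1r x : acong (AMul x (AScal 1)) x
  | acong_mulDl x y z :
      acong (AMul (AAdd x y) z) (AAdd (AMul x z) (AMul y z))
  | acong_mulDr x y z :
      acong (AMul x (AAdd y z)) (AAdd (AMul x y) (AMul x z))
  | acong_scalD a b : acong (AScal (a + b)) (AAdd (AScal a) (AScal b))
  | acong_scalM a b : acong (AScal (a * b)) (AMul (AScal a) (AScal b))
  | acong_scalC a x : acong (AMul (AScal a) x) (AMul x (AScal a)).

HB.instance Definition _ := gen_eqMixin aexp.
HB.instance Definition _ := gen_choiceMixin aexp.

Definition acongb (x y : aexp) : bool := `[< acong x y >].

Lemma acongb_equiv : equiv_class_of acongb.
Proof.
split.
- by move=> x; apply/asboolP; apply: acong_refl.
- by move=> x y; apply/asboolP/asboolP => h; apply: acong_sym.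
- move=> y x z /asboolP h1 /asboolP h2; apply/asboolP.
  exact: acong_trans h1 h2.
Qed.

Canonical acong_equiv := EquivRelPack acongb_equiv.

Definition palg := {eq_quot acong_equiv}.
HB.instance Definition _ := Choice.on palg.

Definition pcls (x : aexp) : palg := \pi_palg x.

Lemma pclsP x y : pcls x = pcls y <-> acong x y.
Proof.
rewrite /pcls; split.
- by move=> /eqP; rewrite eqmodE => /asboolP.
- by move=> h; apply/eqP; rewrite eqmodE; apply/asboolP.
Qed.

Lemma pclsW (P : palg -> Prop) : (forall x, P (pcls x)) -> forall a, P a.
Proof. by move=> h a; rewrite -[a]reprK; apply: h. Qed.

Lemma acong_repr x : acong (repr (pcls x)) x.
Proof. by apply/pclsP; rewrite /pcls reprK. Qed.

Definition padd (a b : palg) : palg := pcls (AAdd (repr a) (repr b)).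
Definition pmul (a b : palg) : palg := pcls (AMul (repr a) (repr b)).
Definition pscal (a : F) : palg := pcls (AScal a).
Definition popp (a : palg) : palg := pmul (pscal (-1)) a.

Lemma paddE x y : padd (pcls x) (pcls y) = pcls (AAdd x y).
Proof. by apply/pclsP; apply: acong_add; apply: acong_repr. Qed.
Lemma pmulE x y : pmul (pcls x) (pcls y) = pcls (AMul x y).
Proof. by apply/pclsP; apply: acong_mul; apply: acong_repr. Qed.

Lemma paddA : associative padd.
Proof.
elim/pclsW=> x; elim/pclsW=> y; elim/pclsW=> z; rewrite !paddE.
by apply/pclsP; apply: acong_addA.
Qed.
Lemma paddC : commutative padd.
Proof.
elim/pclsW=> x; elim/pclsW=> y; rewrite !paddE.
by apply/pclsP; apply: acong_addC.
Qed.
Lemma padd0 : left_id (pscal 0) padd.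
Proof. by elim/pclsW=> x; rewrite paddE; apply/pclsP; apply: acong_add0. Qed.
Lemma paddN : left_inverse (pscal 0) popp padd.
Proof.
by elim/pclsW=> x; rewrite /popp pmulE paddE; apply/pclsP; apply: acong_addN.
Qed.
HB.instance Definition _ := GRing.isZmodule.Build palg paddA paddC padd0 paddN.

Lemma pmulA : associative pmul.
Proof.
elim/pclsW=> x; elim/pclsW=> y; elim/pclsW=> z; rewrite !pmulE.
by apply/pclsP; apply: acong_mulA.
Qed.
Lemma pmul1l : left_id (pscal 1) pmul.
Proof. by elim/pclsW=> x; rewrite pmulE; apply/pclsP; apply: acong_mul1l. Qed.
Lemma pmul1r : right_id (pscal 1) pmul.
Proof. by elim/pclsW=> x; rewrite pmulE; apply/pclsP; apply: acong_mul1r. Qed.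
Lemma pmulDl : left_distributive pmul padd.
Proof.
elim/pclsW=> x; elim/pclsW=> y; elim/pclsW=> z; rewrite !(paddE, pmulE).
by apply/pclsP; apply: acong_mulDl.
Qed.
Lemma pmulDr : right_distributive pmul padd.
Proof.
elim/pclsW=> x; elim/pclsW=> y; elim/pclsW=> z; rewrite !(paddE, pmulE).
by apply/pclsP; apply: acong_mulDr.
Qed.
HB.instance Definition _ :=
  GRing.Zmodule_isPzRing.Build palg pmulA pmul1l pmul1r pmulDl pmulDr.

Lemma pclsD x y : pcls (AAdd x y) = pcls x + pcls y.
Proof. by rewrite -paddE. Qed.
Lemma pclsM x y : pcls (AMul x y) = pcls x * pcls y.
Proof. by rewrite -pmulE. Qed.
Lemma pcls0 : pcls (AScal 0) = 0. Proof. by []. Qed.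
Lemma pcls1 : pcls (AScal 1) = 1. Proof. by []. Qed.

Definition pgen (i : I) : palg := pcls (AGen i).

Definition pscale (a : F) (x : palg) : palg := pscal a * x.
Lemma pscaleA a b x : pscale a (pscale b x) = pscale (a * b) x.
Proof.
by rewrite /pscale mulrA -pclsM; congr (_ * _); apply/pclsP/acong_sym/acong_scalM.
Qed.
Lemma pscale1 : left_id 1 pscale.
Proof. by move=> x; apply: mul1r. Qed.
Lemma pscaleDr : right_distributive pscale +%R.
Proof. by move=> a x y; apply: mulrDr. Qed.
Lemma pscaleDl x : {morph pscale^~ x : a b / a + b}.
Proof.
move=> a b; rewrite /pscale -mulrDl -pclsD; congr (_ * _).
by apply/pclsP/acong_scalD.
Qed.
HB.instance Definition _ :=
  GRing.Zmodule_isLmodule.Build F palg pscaleA pscale1 pscaleDr pscaleDl.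

Lemma palg_scalerAl (a : F) (x y : palg) : a *: (x * y) = (a *: x) * y.
Proof. exact: mulrA. Qed.
Lemma palg_scalerAr (a : F) (x y : palg) : a *: (x * y) = x * (a *: y).
Proof.
rewrite /GRing.scale /= /pscale !mulrA; congr (_ * _).
by elim/pclsW: x => x; rewrite -!pclsM; apply/pclsP/acong_scalC.
Qed.

End PresentedAlgebra.

(* A vector space with one operator per generator, satisfying the relations,
   is a module over the presented algebra. *)

Section Representation.
Variables (F : fieldType) (I : Type) (rel : aexp F I -> aexp F I -> Prop).

Fixpoint aact (V : lmodType F) (op : I -> V -> V) (x : aexp F I) (v : V) : V :=
  match x with
  | AGen i => op i v
  | AScal a => a *: v
  | AAdd y z => aact op y v + aact op z v
  | AMul y z => aact op y (aact op z v)
  end.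

Record rep := Rep {
  rep_space : lmodType F;
  rep_op : I -> {linear rep_space -> rep_space};
  rep_rel : forall x y, rel x y -> aact rep_op x =1 aact rep_op y
}.

Definition rep_mod (r : rep) : Type := rep_space r.
HB.instance Definition _ (r : rep) := GRing.Zmodule.copy (rep_mod r) (rep_space r).

Variable r : rep.
Let V := rep_space r.
Let op := @rep_op r.

Lemma aact_linear x : linear (aact op x).
Proof.
elim: x => [i|a|x IHx y IHy|x IHx y IHy] c u v /=.
- exact: linearP.
- by rewrite scalerDr !scalerA mulrC.
- by rewrite IHx IHy scalerDr addrACA.
- by rewrite IHy IHx.
Qed.
Lemma aactD x u v : aact op x (u + v) = aact op x u + aact op x v.
Proof. by have := aact_linear x 1 u v; rewrite !scale1r. Qed.
Lemma aact0 x : aact op x 0 = 0.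
Proof. by have := aactD x 0 0; rewrite addr0 => /eqP; rewrite -subr_eq0 opprD addNKr oppr_eq0 => /eqP. Qed.
Lemma aactZ x a v : aact op x (a *: v) = a *: aact op x v.
Proof. by have := aact_linear x a v 0; rewrite !addr0 aact0 addr0. Qed.

Lemma aact_cong x y : acong rel x y -> aact op x =1 aact op y.
Proof.
elim=> {x y} /=.
- by move=> x y /rep_rel.
- by [].
- by move=> x y _ IH v; rewrite IH.
- by move=> x y z _ IH1 _ IH2 v; rewrite IH1 IH2.
- by move=> x x' y y' _ IH1 _ IH2 v; rewrite IH1 IH2.
- by move=> x x' y y' _ IH1 _ IH2 v; rewrite IH1 IH2.
- by move=> x y z v; rewrite addrA.
- by move=> x y v; rewrite addrC.
- by move=> x v; rewrite scale0r add0r.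
- by move=> x v; rewrite scaleN1r addNr scale0r.
- by [].
- by move=> x v; rewrite scale1r.
- by move=> x v; rewrite scale1r.
- by [].
- by move=> x y z v; rewrite aactD.
- by move=> a b v; rewrite scalerDl.
- by move=> a b v; rewrite scalerA.
- by move=> a x v; rewrite aactZ.
Qed.

Definition rep_scale (a : palg rel) (v : rep_mod r) : rep_mod r :=
  aact op (repr a) v.

Lemma rep_scaleE x v : rep_scale (pcls rel x) v = aact op x v.
Proof. by rewrite /rep_scale; apply: aact_cong; apply: acong_repr. Qed.

Lemma rep_scaleA a b v : rep_scale a (rep_scale b v) = rep_scale (a * b) v.
Proof. by elim/pclsW: a => x; elim/pclsW: b => y; rewrite -pclsM !rep_scaleE. Qed.
Lemma rep_scale1 : left_id 1 rep_scale.
Proof. by move=> v; rewrite -pcls1 rep_scaleE /= scale1r. Qed.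
Lemma rep_scaleDr : right_distributive rep_scale +%R.
Proof. by move=> a u v; elim/pclsW: a => x; rewrite !rep_scaleE; apply: aactD. Qed.
Lemma rep_scaleDl v : {morph rep_scale^~ v : a b / a + b}.
Proof.
by elim/pclsW=> x; elim/pclsW=> y; rewrite -pclsD !rep_scaleE.
Qed.
HB.instance Definition _ := GRing.Zmodule_isLmodule.Build (palg rel) (rep_mod r)
  rep_scaleA rep_scale1 rep_scaleDr rep_scaleDl.

Lemma rep_genE i (v : rep_mod r) : pgen rel i *: v = op i v.
Proof. exact: rep_scaleE. Qed.

End Representation.

(* The morphism of presented algebras renaming the generators along [f]. *)

Section RenamingMorphism.
Variables (F : fieldType) (I J : Type) (f : I -> J).
Variables (rI : aexp F I -> aexp F I -> Prop) (rJ : aexp F J -> aexp F J -> Prop).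

Fixpoint amap (x : aexp F I) : aexp F J :=
  match x with
  | AGen i => AGen F (f i)
  | AScal a => AScal J a
  | AAdd y z => AAdd (amap y) (amap z)
  | AMul y z => AMul (amap y) (amap z)
  end.

Hypothesis f_rel : forall x y, rI x y -> rJ (amap x) (amap y).

Lemma amap_cong x y : acong rI x y -> acong rJ (amap x) (amap y).
Proof.
elim=> {x y} /=; try by constructor.
- by move=> x y /f_rel; apply: acong_rel.
- by move=> x y z _ h1 _ h2; apply: acong_trans h1 h2.
Qed.

Definition pmap_alg of (forall x y, rI x y -> rJ (amap x) (amap y)) :=
  fun a : palg rI => pcls rJ (amap (repr a)).
Local Notation phi := (pmap_alg f_rel).

Lemma pmap_algE x : phi (pcls rI x) = pcls rJ (amap x).
Proof. by apply/pclsP; apply: amap_cong; apply: acong_repr. Qed.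

Lemma pmap_alg_zmod : zmod_morphism phi.
Proof.
have phiD a b : phi (a + b) = phi a + phi b.
  by elim/pclsW: a => x; elim/pclsW: b => y; rewrite -pclsD !pmap_algE /= pclsD.
by move=> a b; apply/eqP; rewrite eq_sym subr_eq -phiD subrK.
Qed.
Lemma pmap_alg_monoid : monoid_morphism phi.
Proof.
split=> [|a b]; first by rewrite -pcls1 pmap_algE.
by elim/pclsW: a => x; elim/pclsW: b => y; rewrite -pclsM !pmap_algE /= pclsM.
Qed.
HB.instance Definition _ := GRing.isZmodMorphism.Build _ _ phi pmap_alg_zmod.
HB.instance Definition _ := GRing.isMonoidMorphism.Build _ _ phi pmap_alg_monoid.

End RenamingMorphism.

(* Extension of scalars: Ind f N is the left B-module B (x)_A N, where A acts
   on the right of B through f. *)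

Section Induction.
Variables (A B : pzRingType) (f : {rmorphism A -> B}) (N : lmodType A).

Inductive texp : Type :=
  | TPure of B & N
  | TZero
  | TOpp of texp
  | TAdd of texp & texp.

Inductive tcong : texp -> texp -> Prop :=
  | tcong_refl x : tcong x x
  | tcong_sym x y : tcong x y -> tcong y x
  | tcong_trans x y z : tcong x y -> tcong y z -> tcong x z
  | tcong_opp x x' : tcong x x' -> tcong (TOpp x) (TOpp x')
  | tcong_add x x' y y' :
      tcong x x' -> tcong y y' -> tcong (TAdd x y) (TAdd x' y')
  | tcong_addA x y z : tcong (TAdd x (TAdd y z)) (TAdd (TAdd x y) z)
  | tcong_addC x y : tcong (TAdd x y) (TAdd y x)
  | tcong_add0 x : tcong (TAdd TZero x) x
  | tcong_addN x : tcong (TAdd (TOpp x) x) TZero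
  | tcong_pureDl b b' v :
      tcong (TPure (b + b') v) (TAdd (TPure b v) (TPure b' v))
  | tcong_pureDr b v v' :
      tcong (TPure b (v + v')) (TAdd (TPure b v) (TPure b v'))
  | tcong_balanced b a v : tcong (TPure (b * f a) v) (TPure b (a *: v)).

HB.instance Definition _ := gen_eqMixin texp.
HB.instance Definition _ := gen_choiceMixin texp.

Definition tcongb (x y : texp) : bool := `[< tcong x y >].

Lemma tcongb_equiv : equiv_class_of tcongb.
Proof.
split.
- by move=> x; apply/asboolP; apply: tcong_refl.
- by move=> x y; apply/asboolP/asboolP => h; apply: tcong_sym.
- move=> y x z /asboolP h1 /asboolP h2; apply/asboolP.
  exact: tcong_trans h1 h2.
Qed.

Canonical tcong_equiv := EquivRelPack tcongb_equiv.

Definition Ind := {eq_quot tcong_equiv}.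
HB.instance Definition _ := Choice.on Ind.

Definition tcls (x : texp) : Ind := \pi_Ind x.

Lemma tclsP x y : tcls x = tcls y <-> tcong x y.
Proof.
rewrite /tcls; split.
- by move=> /eqP; rewrite eqmodE => /asboolP.
- by move=> h; apply/eqP; rewrite eqmodE; apply/asboolP.
Qed.

Lemma tclsW (P : Ind -> Prop) : (forall x, P (tcls x)) -> forall a, P a.
Proof. by move=> h a; rewrite -[a]reprK; apply: h. Qed.

Lemma tcong_repr x : tcong (repr (tcls x)) x.
Proof. by apply/tclsP; rewrite /tcls reprK. Qed.

Definition tadd (a b : Ind) : Ind := tcls (TAdd (repr a) (repr b)).
Definition topp (a : Ind) : Ind := tcls (TOpp (repr a)).

Lemma taddE x y : tadd (tcls x) (tcls y) = tcls (TAdd x y).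
Proof. by apply/tclsP; apply: tcong_add; apply: tcong_repr. Qed.
Lemma toppE x : topp (tcls x) = tcls (TOpp x).
Proof. by apply/tclsP; apply: tcong_opp; apply: tcong_repr. Qed.

Lemma taddA : associative tadd.
Proof.
elim/tclsW=> x; elim/tclsW=> y; elim/tclsW=> z; rewrite !taddE.
by apply/tclsP; apply: tcong_addA.
Qed.
Lemma taddC : commutative tadd.
Proof.
elim/tclsW=> x; elim/tclsW=> y; rewrite !taddE.
by apply/tclsP; apply: tcong_addC.
Qed.
Lemma tadd0 : left_id (tcls TZero) tadd.
Proof. by elim/tclsW=> x; rewrite taddE; apply/tclsP; apply: tcong_add0. Qed.
Lemma taddN : left_inverse (tcls TZero) topp tadd.
Proof.
by elim/tclsW=> x; rewrite toppE taddE; apply/tclsP; apply: tcong_addN.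
Qed.
HB.instance Definition _ := GRing.isZmodule.Build Ind taddA taddC tadd0 taddN.

Lemma tclsD x y : tcls (TAdd x y) = tcls x + tcls y.
Proof. by rewrite -taddE. Qed.

Fixpoint tact (b : B) (x : texp) : texp :=
  match x with
  | TPure b' v => TPure (b * b') v
  | TZero => TZero
  | TOpp y => TOpp (tact b y)
  | TAdd y z => TAdd (tact b y) (tact b z)
  end.

Lemma tact_cong b x y : tcong x y -> tcong (tact b x) (tact b y).
Proof.
elim=> {x y} /=; try by constructor.
- by move=> x y z _ h1 _ h2; apply: tcong_trans h1 h2.
- by move=> b1 b2 v; rewrite mulrDr; apply: tcong_pureDl.
- by move=> b1 a v; rewrite mulrA; apply: tcong_balanced.
Qed.

Definition tscale (b : B) (x : Ind) : Ind := tcls (tact b (repr x)).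
Lemma tscaleE b x : tscale b (tcls x) = tcls (tact b x).
Proof. by apply/tclsP; apply: tact_cong; apply: tcong_repr. Qed.

Lemma tscaleA a b x : tscale a (tscale b x) = tscale (a * b) x.
Proof.
elim/tclsW: x => x; rewrite !tscaleE; congr tcls.
by elim: x => //= [b' v|x ->|x -> y ->] //; rewrite mulrA.
Qed.
Lemma tscale1 : left_id 1 tscale.
Proof.
elim/tclsW=> x; rewrite tscaleE; congr tcls.
by elim: x => //= [b' v|x ->|x -> y ->] //; rewrite mul1r.
Qed.
Lemma tscaleDr : right_distributive tscale +%R.
Proof.
by move=> b; elim/tclsW=> x; elim/tclsW=> y; rewrite -tclsD !tscaleE /= tclsD.
Qed.
Lemma tscaleDl x : {morph tscale^~ x : a b / a + b}.
Proof.
move=> a b; elim/tclsW: x => x; rewrite !tscaleE.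
elim: x => [b' v||x IH|x IHx y IHy] /=.
- by rewrite -tclsD mulrDl; apply/tclsP/tcong_pureDl.
- by rewrite -tclsD; apply/tclsP/tcong_sym/tcong_add0.
- by rewrite -!toppE IH; apply: opprD.
- by rewrite !tclsD IHx IHy addrACA.
Qed.
HB.instance Definition _ :=
  GRing.Zmodule_isLmodule.Build B Ind tscaleA tscale1 tscaleDr tscaleDl.

Definition tens (b : B) (v : N) : Ind := tcls (TPure b v).

End Induction.

(* Indices are shifted by one: 'I_n stands for [n] and 'I_n.-1 for [n-1], so
   that i : 'I_n.-1 is the index of a generator pi_{i+1}; [low i] and [high i]
   are then the elements i+1 and i+2 of [n]. *)

Section Indices.
Variable n : nat.

Lemma low_proof (i : 'I_n.-1) : (i < n)%N.
Proof. exact: leq_trans (ltn_ord i) (leq_pred n). Qed.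
Lemma high_proof (i : 'I_n.-1) : (i.+1 < n)%N.
Proof. by case: i => i /=; case: n. Qed.
Definition low (i : 'I_n.-1) : 'I_n := Ordinal (low_proof i).
Definition high (i : 'I_n.-1) : 'I_n := Ordinal (high_proof i).

End Indices.

Declare Scope aexp_scope.
Delimit Scope aexp_scope with A.
Local Notation "x + y" := (AAdd x y) : aexp_scope.
Local Notation "x * y" := (AMul x y) : aexp_scope.
Local Notation "-1" := (AScal _ (-1)%R) : aexp_scope.
Local Notation "1" := (AScal _ 1%R) : aexp_scope.

Section Hecke.
Variables (F : fieldType) (n : nat).

Section HeckeRelations.
Variables (J : Type) (gen_pi : 'I_n.-1 -> J).
Let pi i : aexp F J := AGen F (gen_pi i).

Inductive hecke_rel : aexp F J -> aexp F J -> Prop :=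
  | hecke_quad i : hecke_rel (pi i * pi i)%A (-1 * pi i)%A
  | hecke_comm (i j : 'I_n.-1) : (i.+1 < j)%N || (j.+1 < i)%N ->
      hecke_rel (pi i * pi j)%A (pi j * pi i)%A
  | hecke_braid (i j : 'I_n.-1) : j = i.+1 :> nat ->
      hecke_rel (pi i * pi j * pi i)%A (pi j * pi i * pi j)%A.
End HeckeRelations.

Definition H0_rel := @hecke_rel 'I_n.-1 id.
Definition H0 := palg H0_rel.
HB.instance Definition _ := GRing.PzRing.on H0.
HB.instance Definition _ := GRing.Lmodule.on H0.

Inductive hcl_gen : Type := GPi of 'I_n.-1 | GCl of 'I_n.
Let pi i : aexp F hcl_gen := AGen F (GPi i).
Let c j : aexp F hcl_gen := AGen F (GCl j).

Inductive HCl0_rel : aexp F hcl_gen -> aexp F hcl_gen -> Prop :=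
  | HCl0_hecke x y : hecke_rel GPi x y -> HCl0_rel x y
  | HCl0_cliff_sq j : HCl0_rel (c j * c j)%A (-1)%A
  | HCl0_cliff_anti i j : i != j -> HCl0_rel (c i * c j)%A (-1 * (c j * c i))%A
  | HCl0_far i j : j != low i -> j != high i ->
      HCl0_rel (pi i * c j)%A (c j * pi i)%A
  | HCl0_low i : HCl0_rel (pi i * c (low i))%A (c (high i) * pi i)%A
  | HCl0_high i :
      HCl0_rel ((pi i + 1) * c (high i))%A (c (low i) * (pi i + 1))%A.
Definition HCl0 := palg HCl0_rel.
HB.instance Definition _ := GRing.PzRing.on HCl0.
HB.instance Definition _ := GRing.Lmodule.on HCl0.

Lemma H0_to_HCl0_rel x y : H0_rel x y -> HCl0_rel (amap GPi x) (amap GPi y).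
Proof. by case=> *; apply: HCl0_hecke; constructor. Qed.

Definition H0_to_HCl0 : {rmorphism H0 -> HCl0} := pmap_alg H0_to_HCl0_rel.

End Hecke.

(* Only the set of boxes and its reading order matter for the modules: a
   diagram is a finite type of boxes listed in reading order. *)
Record diagram (n : nat) := Diagram {
  box : finType;
  reading : seq box;
  reading_perm : perm_eq reading (enum box);
  box_card : #|box| = n
}.

Section DiagramModules.
Variables (n : nat) (D : diagram n).

Definition filling := {ffun box D -> 'I_n}.

Definition standard (T : filling) : Prop := bijective T.

Definition rw (T : filling) : seq 'I_n := [seq T b | b <- reading D].

Definition swap (i : 'I_n.-1) (T : filling) : filling :=
  [ffun b => tperm (low i) (high i) (T b)].

Definition Des (T : filling) : {set 'I_n.-1} :=
  [set i | (index (high i) (rw T) < index (low i) (rw T))%N].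

Definition attacking (tabs : {set filling}) (T : filling) (i : 'I_n.-1) : bool :=
  (i \notin Des T) && (swap i T \notin tabs).

(* i is an ascent of T in positions (r, s); positions are counted from 0. *)
Definition ascent_at (T : filling) (i : 'I_n.-1) (r s : nat) : bool :=
  [&& (r < s)%N, onth (rw T) r == Some (low i) & onth (rw T) s == Some (high i)].

Definition ascent_compatible (tabs : {set filling}) : Prop :=
  forall T T' i i' r s, T \in tabs -> T' \in tabs ->
    ascent_at T i r s -> ascent_at T' i' r s ->
    attacking tabs T i = attacking tabs T' i'.

Record tab_family := TabFamily {
  tabs :> {set filling};
  tabs_standard : forall T, T \in tabs -> standard T;
  tabs_compatible : ascent_compatible tabs
}.

Section Positions.

Definition pos (T : filling) (k : 'I_n) : nat := index k (rw T).

Lemma mem_rw T k : standard T -> k \in rw T.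
Proof.
case=> g gK Kg; apply/mapP; exists (g k); last by rewrite Kg.
by rewrite (perm_mem (reading_perm D)) mem_enum.
Qed.

Lemma rw_swap i T : rw (swap i T) = [seq tperm (low i) (high i) k | k <- rw T].
Proof. by rewrite /rw -map_comp; apply: eq_map => b; rewrite /= ffunE. Qed.

Lemma pos_swap i T k : pos (swap i T) k = pos T (tperm (low i) (high i) k).
Proof.
rewrite /pos rw_swap -{1}[k](tpermK (low i) (high i)).
by rewrite index_map //; apply: perm_inj.
Qed.

Lemma pos_inj T : standard T -> injective (pos T).
Proof.
move=> sT k l e; rewrite -(nth_index k (mem_rw k sT)) -/(pos T k) e.
by rewrite /pos nth_index // mem_rw.
Qed.

Lemma onth_pos T k : standard T -> onth (rw T) (pos T k) = Some k.
Proof.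
move=> sT; have hk := mem_rw k sT.
by rewrite /pos (onthE) (nth_map k) ?index_mem // nth_index.
Qed.

Lemma ascent_atP T i : standard T -> i \notin Des T ->
  ascent_at T i (pos T (low i)) (pos T (high i)).
Proof.
move=> sT; rewrite inE -leqNgt leq_eqVlt => /orP [/eqP /(pos_inj sT)|lt].
  by move=> /(congr1 val) /= /eqP; rewrite eqn_leq ltnn andbF.
by rewrite /ascent_at lt !onth_pos // !eqxx.
Qed.

Lemma swapK i : involutive (swap i).
Proof. by move=> T; apply/ffunP => b; rewrite !ffunE tpermK. Qed.

Lemma compat_swap (X : tab_family) T T' i i' :
  T \in X -> T' \in X -> i \notin Des T -> i' \notin Des T' ->
  pos T (low i) = pos T' (low i') -> pos T (high i) = pos T' (high i') ->
  (swap i T \in X) = (swap i' T' \in X).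
Proof.
move=> hT hT' ai ai' e1 e2.
have sT := tabs_standard hT; have sT' := tabs_standard hT'.
have := tabs_compatible hT hT' (ascent_atP sT ai).
rewrite e1 e2 => /(_ i' (ascent_atP sT' ai')).
by rewrite /attacking ai ai' /= => /negb_inj.
Qed.

End Positions.

Section Module.
Variables (F : fieldType) (X : tab_family).

Definition Nspace := {ffun {T : filling | T \in tabs X} -> F^o}.
HB.instance Definition _ := GRing.Lmodule.on Nspace.

(* The basis vector T of the span of X; it is 0 when T is not in X. *)
Definition tab (T : filling) : Nspace := [ffun U => (val U == T)%:R].

Definition pi_tab (i : 'I_n.-1) (T : filling) : Nspace :=
  if i \in Des T then - tab T
  else if attacking X T i then 0
  else tab (swap i T).

Definition N_op (i : 'I_n.-1) (v : Nspace) : Nspace :=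
  \sum_(T : {T : filling | T \in tabs X}) v T *: pi_tab i (val T).

Lemma N_op_linear i : linear (N_op i).
Proof.
move=> a u v; rewrite /N_op scaler_sumr -big_split /=.
by apply: eq_bigr => T _; rewrite !ffunE scalerDl scalerA.
Qed.
HB.instance Definition _ i :=
  GRing.isLinear.Build F Nspace Nspace *:%R (N_op i) (N_op_linear i).

Lemma N_opN i v : N_op i (- v) = - N_op i v.
Proof. exact: linearN. Qed.
Lemma N_op0 i : N_op i 0 = 0.
Proof. exact: linear0. Qed.

Lemma tab_out T : T \notin X -> tab T = 0.
Proof.
move=> hT; apply/ffunP => U; rewrite !ffunE.
by case: eqP => // e; rewrite -e (valP U) in hT.
Qed.

Lemma N_op_tab i T : T \in X -> N_op i (tab T) = pi_tab i T.
Proof.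
move=> hT; rewrite /N_op (bigD1 (exist _ T hT)) //= big1 ?addr0.
  by rewrite ffunE eqxx scale1r.
move=> U hU; rewrite ffunE; case: eqP => [e|]; last by rewrite scale0r.
by case/eqP: hU; apply: val_inj.
Qed.

Lemma N_step i T : T \in X ->
  N_op i (tab T) = if i \in Des T then - tab T
                   else if swap i T \in X then tab (swap i T) else 0.
Proof.
move=> hT; rewrite N_op_tab // /pi_tab /attacking.
by case: (i \in Des T); case: (swap i T \in X).
Qed.

Lemma Nspace_sum (v : Nspace) :
  v = \sum_(T : {T : filling | T \in tabs X}) v T *: tab (val T).
Proof.
apply/ffunP => U; rewrite sum_ffunE (bigD1 U) //= big1 => [|T hT].
  by rewrite !ffunE eqxx addr0 /GRing.scale /= mulr1.
rewrite !ffunE; case: eqP => [/val_inj e|_]; last by rewrite scaler0.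
by rewrite e eqxx in hT.
Qed.

Lemma linear_tab_ext (f g : Nspace -> Nspace) : linear f -> linear g ->
  (forall T, T \in X -> f (tab T) = g (tab T)) -> f =1 g.
Proof.
move=> lf lg h v.
pose f' := GRing.isLinear.Build F Nspace Nspace *:%R f lf.
pose g' := GRing.isLinear.Build F Nspace Nspace *:%R g lg.
pose fL : {linear Nspace -> Nspace} := HB.pack f f'.
pose gL : {linear Nspace -> Nspace} := HB.pack g g'.
rewrite -[f]/(fL : _ -> _) -[g]/(gL : _ -> _) [v]Nspace_sum !linear_sum.
by apply: eq_bigr => T _; rewrite !linearZ; congr (_ *: _); apply: h (valP T).
Qed.

Lemma N_quad T i : T \in X -> N_op i (N_op i (tab T)) = - N_op i (tab T).
Proof.
move=> hT; rewrite N_step //; case: ifP => di; first by rewrite N_opN N_step // di.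
case: ifP => hs; last by rewrite N_op0 oppr0.
rewrite N_step // ifT // inE -/(pos _ _) -/(pos _ _) !pos_swap tpermL tpermR.
have sT := tabs_standard hT.
by have /and3P[] := ascent_atP sT (negbT di).
Qed.

Lemma low_high (i : 'I_n.-1) : low i != high i.
Proof. by rewrite -val_eqE /= eqn_leq ltnn andbF. Qed.

Lemma N_comm T (i j : 'I_n.-1) : T \in X -> (i.+1 < j)%N || (j.+1 < i)%N ->
  N_op i (N_op j (tab T)) = N_op j (N_op i (tab T)).
Proof.
move=> hT far.
have [ll lh hl hh] : [/\ low i != low j, low i != high j,
                        high i != low j & high i != high j].
  by rewrite -!val_eqE /=; split; lia.
have Di U : (i \in Des (swap j U)) = (i \in Des U).
  by rewrite !inE -!/(pos _ _) !pos_swap !tpermD // eq_sym.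
have Dj U : (j \in Des (swap i U)) = (j \in Des U).
  by rewrite !inE -!/(pos _ _) !pos_swap !tpermD.
have sC : swap i (swap j T) = swap j (swap i T).
  apply/ffunP => b; rewrite !ffunE; move: (T b) => k.
  have [->|kl] := eqVneq k (low i).
    by rewrite tpermL !(tpermD (x := low j)) 1?eq_sym // tpermL.
  have [->|kh] := eqVneq k (high i).
    by rewrite tpermR !(tpermD (x := low j)) 1?eq_sym // tpermR.
  rewrite (tpermD (x := low i) (z := k)) 1?eq_sym //.
  by rewrite tpermD //; case: tpermP => // *; rewrite eq_sym.
rewrite !N_step //.
case: (boolP (i \in Des T)) => di; case: (boolP (j \in Des T)) => dj.
- by rewrite !N_opN !N_step // di dj.
- rewrite N_opN N_step // (negbTE dj); case: ifP => hj; last by rewrite N_op0 oppr0.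
  by rewrite N_step // Di di.
- rewrite N_opN N_step // (negbTE di); case: ifP => hi; last by rewrite N_op0 oppr0.
  by rewrite N_step // Dj dj.
have Ei : swap j T \in X -> (swap i (swap j T) \in X) = (swap i T \in X).
  by move=> h; apply: compat_swap => //; rewrite ?Di // !pos_swap tpermD // eq_sym.
have Ej : swap i T \in X -> (swap j (swap i T) \in X) = (swap j T \in X).
  by move=> h; apply: compat_swap => //; rewrite ?Dj // !pos_swap tpermD.
case: ifP => hj; case: ifP => hi; rewrite ?N_op0 ?N_step // ?Di ?Dj
  ?(negbTE di) ?(negbTE dj) ?Ei ?Ej ?hi ?hj ?sC //.
Qed.

Lemma DesP T k : (k \in Des T) = (pos T (high k) < pos T (low k))%N.
Proof. by rewrite inE. Qed.

Lemma N_braid T (i j : 'I_n.-1) : T \in X -> j = i.+1 :> nat ->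
  N_op i (N_op j (N_op i (tab T))) = N_op j (N_op i (N_op j (tab T))).
Proof.
move=> hT eij.
set a := low i; set b := high i; set c := high j.
have eb : low j = b by apply: val_inj.
have ab : a != b by exact: low_high.
have bc : b != c by rewrite -eb; exact: low_high.
have ac : a != c by rewrite -val_eqE /= eij; lia.
have ba : b != a by rewrite eq_sym.
have cb : c != b by rewrite eq_sym.
have ca : c != a by rewrite eq_sym.
have sT := tabs_standard hT.
have psa U : pos (swap i U) a = pos U b by rewrite pos_swap tpermL.
have psb U : pos (swap i U) b = pos U a by rewrite pos_swap tpermR.
have psc U : pos (swap i U) c = pos U c by rewrite pos_swap tpermD.
have pta U : pos (swap j U) a = pos U a.
  by rewrite pos_swap tpermD // ?eb // eq_sym.
have ptb U : pos (swap j U) b = pos U c by rewrite pos_swap eb tpermL.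
have ptc U : pos (swap j U) c = pos U b by rewrite pos_swap -eb tpermR.
have pE := (psa, psb, psc, pta, ptb, ptc).
have di U : (i \in Des U) = (pos U b < pos U a)%N by rewrite DesP.
have dj U : (j \in Des U) = (pos U c < pos U b)%N by rewrite DesP eb.
have dE := (di, dj).
have nab : pos T a <> pos T b by move/(pos_inj sT)/eqP; apply/negP.
have nbc : pos T b <> pos T c by move/(pos_inj sT)/eqP; apply/negP.
have nac : pos T a <> pos T c by move/(pos_inj sT)/eqP; apply/negP.
have sB : swap i (swap j (swap i T)) = swap j (swap i (swap j T)).
  apply/ffunP => x; rewrite !ffunE eb -/a -/b -/c; move: (T x) => k.
  have [->|ka] := eqVneq k a.
    by rewrite tpermL tpermL (tpermD (x := a)) // (tpermD (x := b) (z := a)) // tpermL tpermL.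
  have [->|kb] := eqVneq k b.
    by rewrite tpermR tpermL (tpermD (x := b) (z := a)) // tpermL (tpermD (x := a) (z := c)) // tpermR.
  have [->|kc] := eqVneq k c.
    by rewrite (tpermD (x := a) (z := c)) // !tpermR (tpermD (x := b) (z := a)).
  by rewrite !tpermD // eq_sym.
rewrite !(N_step _ hT) !dE.
case: (ltngtP (pos T b) (pos T a)) => [hba|hab|e]; last by case: nab.
- case: (ltngtP (pos T c) (pos T b)) => [hcb|hbc|e]; last by case: nbc.
    rewrite !N_opN !N_step // !dE hba hcb !N_opN !N_step // !dE hba hcb.
    by rewrite !opprK.
  rewrite !N_opN N_step // !dE ltnNge (ltnW hbc) /=.
  case: ifP => ht; last by rewrite !N_op0 oppr0.
  rewrite N_step // !dE !pE.
  case: (ltngtP (pos T c) (pos T a)) => [hca|hac|e]; last by case: nac.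
    by rewrite N_opN N_step // !dE !pE hbc !opprK.
  case: ifP => hs; last by rewrite N_op0 oppr0.
  by rewrite N_step // !dE !pE hba.
- case: (ltngtP (pos T c) (pos T b)) => [hcb|hbc|e]; last by case: nbc.
    rewrite !N_opN [in RHS]N_step // !dE ltnNge (ltnW hab) /=.
    case: ifP => hs; last by rewrite !N_op0 oppr0.
    rewrite N_step // !dE !pE.
    case: (ltngtP (pos T c) (pos T a)) => [hca|hac|e]; last by case: nac.
      by rewrite N_opN N_step // !dE !pE hab !opprK.
    case: ifP => ht; last by rewrite N_op0 oppr0.
    by rewrite N_step // !dE !pE hcb.
have hac : (pos T a < pos T c)%N by exact: ltn_trans hbc.
have f1 : (pos T b < pos T a)%N = false by apply: negbTE; rewrite -leqNgt ltnW.
have f2 : (pos T c < pos T b)%N = false by apply: negbTE; rewrite -leqNgt ltnW.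
have f3 : (pos T c < pos T a)%N = false by apply: negbTE; rewrite -leqNgt ltnW.
have E1 : swap i (swap j T) \in X ->
    (swap i T \in X) = (swap j (swap i (swap j T)) \in X).
  by move=> h; apply: compat_swap; rewrite ?eb ?dE ?pE ?f1 ?f2 ?f3.
have E2 : swap j (swap i T) \in X ->
    (swap j T \in X) = (swap i (swap j (swap i T)) \in X).
  by move=> h; apply: compat_swap; rewrite ?eb ?dE ?pE ?f1 ?f2 ?f3.
have E3 : swap i T \in X -> swap j T \in X ->
    (swap j (swap i T) \in X) = (swap i (swap j T) \in X).
  by move=> h1 h2; apply: compat_swap; rewrite ?eb ?dE ?pE ?f1 ?f2 ?f3.
have L : N_op i (N_op j (if swap i T \in X then tab (swap i T) else 0)) =
  if [&& swap i T \in X, swap j (swap i T) \in X & swap i (swap j (swap i T)) \in X]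
  then tab (swap i (swap j (swap i T))) else 0.
  case: ifP => h1; last by rewrite !N_op0.
  rewrite N_step // dE !pE f3; case: ifP => h2; last by rewrite N_op0.
  by rewrite N_step // dE !pE f2.
have R : N_op j (N_op i (if swap j T \in X then tab (swap j T) else 0)) =
  if [&& swap j T \in X, swap i (swap j T) \in X & swap j (swap i (swap j T)) \in X]
  then tab (swap j (swap i (swap j T))) else 0.
  case: ifP => h1; last by rewrite !N_op0.
  rewrite N_step // dE !pE f3; case: ifP => h2; last by rewrite N_op0.
  by rewrite N_step // dE !pE f1.
rewrite L R sB; congr (if _ then _ else _).
apply/idP/idP => /and3P[h1 h2 h3].
  have h4 : swap j T \in X by rewrite E2 // sB.
  by rewrite h4 h3 -E3 // h2.
have h4 : swap i T \in X by rewrite E1.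
by rewrite h4 h3 E3 // h2.
Qed.

Lemma N_rel x y : H0_rel x y -> aact N_op x =1 aact N_op y.
Proof.
case=> {x y} [i|i j far|i j e]; apply: linear_tab_ext;
  try by move=> a u v; rewrite /= !linearP.
- by move=> T hT; rewrite /= N_quad // scaleN1r.
- by move=> T hT; apply: N_comm.
- by move=> T hT; apply: N_braid.
Qed.

Definition N_rep : rep (@H0_rel F n) :=
  @Rep F _ (@H0_rel F n) Nspace (fun i => N_op i : {linear Nspace -> Nspace}) N_rel.
Definition N : lmodType (H0 F n) := rep_mod N_rep.
Definition Ntilde : lmodType (HCl0 F n) := Ind (H0_to_HCl0 F n) N.

(* T, seen in Ntilde as 1 (x) T. *)
Definition tab_tilde (T : filling) : Ntilde :=
  tens (H0_to_HCl0 F n) 1 (tab T : N).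

Definition generated_by (T : filling) : Prop :=
  forall v : Ntilde, exists a : HCl0 F n, v = a *: tab_tilde T.

Definition tableau_cyclic : Prop := exists2 T, T \in X & generated_by T.

End Module.
End DiagramModules.

Record peak_comp (n : nat) := PeakComp {
  parts :> seq nat;
  parts_gt0 : all (leq 1) parts;
  parts_gt1 : all (leq 2) (take (size parts).-1 parts);
  parts_sum : sumn parts = n
}.

Section PeakCompTheory.
Local Open Scope nat_scope.
Variables (n : nat) (a : peak_comp n).

Lemma peak_gt0 r : r < size a -> 0 < nth 0 a r.
Proof. by move=> h; apply: (allP (parts_gt0 a)); apply: mem_nth. Qed.

Lemma peak_gt1 r : r.+1 < size a -> 1 < nth 0 a r.
Proof.
move=> h; have hr : r < (size a).-1 by lia.
rewrite -(nth_take 0 hr); apply: (allP (parts_gt1 a)); apply: mem_nth.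
by rewrite size_take; case: ifP => _ //; apply: ltnW.
Qed.

Lemma peak_size r c : c < nth 0 a r -> r < size a.
Proof. by case: (ltnP r (size a)) => // h; rewrite nth_default. Qed.

Lemma peak_bound r c : c < 2 -> c < nth 0 a r -> r.*2 + c < n.
Proof.
move=> c2 hc; have hr := peak_size hc.
rewrite -(parts_sum a) -{1}[a : seq nat](cat_take_drop r) sumn_cat (drop_nth 0 hr) /=.
suff : r.*2 <= sumn (take r a) by move: hc; lia.
have : all (leq 2) (take r a).
  have e : take r a = take r (take (size a).-1 a) by rewrite take_takel // -ltnS prednK //; apply: leq_ltn_trans hr.
  rewrite e; apply/allP => k /mem_take; exact: (allP (parts_gt1 a)).
have : size (take r a) = r by rewrite size_takel // ltnW.
move: (take r a) {hr hc c2} => s; elim: s r => [|k s IH] [|r] //= [hs] /andP[hk hall].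
by have := IH r hs hall; lia.
Qed.

End PeakCompTheory.

(* Rows (from bottom to top), columns and entries are all counted from 0. *)

Section PeakTableaux.
Local Open Scope nat_scope.
Variables (n : nat) (alpha : peak_comp n).

Definition dbox : finType := {r : 'I_(size alpha) & 'I_(nth 0 alpha r)}.
Definition row (b : dbox) : nat := tag b.
Definition col (b : dbox) : nat := tagged b.

Definition reads_before (b b' : dbox) : bool :=
  (col b < col b') || (col b == col b') && (row b <= row b').

Lemma dbox_reading_perm : perm_eq (sort reads_before (enum dbox)) (enum dbox).
Proof. by rewrite perm_sort. Qed.

Lemma dbox_card : #|dbox| = n.
Proof.
rewrite card_tagged; apply: etrans (parts_sum alpha); congr sumn.
rewrite -[RHS](mkseq_nth 0) /mkseq -val_enum_ord -map_comp.
by apply: eq_map => i; rewrite /= card_ord.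
Qed.

Definition peak_diagram : diagram n := Diagram dbox_reading_perm dbox_card.

Definition SPCT_pred (T : filling peak_diagram) : Prop :=
  [/\ standard T,
      forall b b' : dbox, row b = row b' -> col b < col b' -> T b < T b',
      forall b b' : dbox, col b = 0 -> col b' = 0 -> row b < row b' -> T b < T b'
    & forall k, 1 <= k <= n -> exists beta : peak_comp k, forall r c,
        c < nth 0 beta r <-> exists b : dbox, [/\ T b < k, row b = r & col b = c]].

Definition SPCT_set : {set filling peak_diagram} := [set T | `[< SPCT_pred T >]].

Lemma SPCTP T : T \in SPCT_set <-> SPCT_pred T.
Proof. by rewrite inE; split => /asboolP. Qed.

Lemma dbox_eq (b b' : dbox) : row b = row b' -> col b = col b' -> b = b'.
Proof.
case: b b' => [r c] [r' c']; rewrite /row /col /= => e.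
have {}e : r = r' by apply: val_inj.
by case: r' / e c' => c' e; congr existT; apply: val_inj.
Qed.

Lemma reads_before_trans : transitive reads_before.
Proof. by move=> y x z; rewrite /reads_before; lia. Qed.
Lemma reads_before_total : total reads_before.
Proof. by move=> x y; rewrite /reads_before; lia. Qed.

Lemma tperm_lt (i : 'I_n.-1) (k l : 'I_n) : k < l ->
  ~ (k = low i /\ l = high i) -> tperm (low i) (high i) k < tperm (low i) (high i) l.
Proof.
move=> kl nkl.
have h : ~ ((k : nat) = i /\ (l : nat) = i.+1).
  by move=> [h1 h2]; apply: nkl; split; apply: val_inj.
case: tpermP => [e1|e1|/eqP e1 /eqP e1']; case: tpermP => [e2|e2|/eqP e2 /eqP e2'];
  move: kl h; rewrite ?e1 ?e2 /=;
  try (move: e1 e1'; rewrite -!val_eqE /=); try (move: e2 e2'; rewrite -!val_eqE /=);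
  lia.
Qed.

Lemma tperm_ltk (i : 'I_n.-1) (l : 'I_n) (k : nat) : k <> i.+1 ->
  (tperm (low i) (high i) l < k) = (l < k).
Proof. by move=> hk; case: tpermP => [->|->|//] /=; lia. Qed.

Section Swap.
Variables (T : filling peak_diagram) (i : 'I_n.-1) (x y : dbox).
Hypotheses (hT : SPCT_pred T) (Tx : T x = low i) (Ty : T y = high i).
Hypothesis xy : index x (reading peak_diagram) < index y (reading peak_diagram).

Let mem_reading (b : dbox) : b \in reading peak_diagram.
Proof. by rewrite (perm_mem (reading_perm peak_diagram)) mem_enum. Qed.

Let Tinj : injective T.
Proof. by case: hT => /bij_inj. Qed.

Lemma swap_colxy : col x <= col y.
Proof.
have := sorted_ltn_index reads_before_trans
  (sort_sorted reads_before_total (enum dbox)) _ _ (mem_reading x) (mem_reading y) xy.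
by rewrite /reads_before; lia.
Qed.

Lemma swap_notDes : i \notin Des T.
Proof.
rewrite inE /rw -Tx -Ty !(index_map Tinj) -leqNgt; exact: ltnW.
Qed.

Let others b : b <> x -> b <> y -> T b <> i :> nat /\ T b <> i.+1 :> nat.
Proof.
move=> bx by_; split=> e.
  by apply: bx; apply: Tinj; rewrite Tx; apply: val_inj.
by apply: by_; apply: Tinj; rewrite Ty; apply: val_inj.
Qed.

Lemma swap_same_row : row x = row y -> ~ SPCT_pred (swap i T).
Proof.
move=> e [_ h1 _ _]; case: hT => _ g1 _ _.
have Txy : T x < T y by rewrite Tx Ty.
case: (ltngtP (col x) (col y)) => c.
- by have := h1 _ _ e c; rewrite !ffunE Tx Ty tpermL tpermR /=; lia.
- by have := g1 _ _ (esym e) c; lia.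
- by move: xy; rewrite (dbox_eq e c) ltnn.
Qed.

Lemma swap_diff_row : row x <> row y -> SPCT_pred (swap i T).
Proof.
move=> ne; case: (hT) => sT g1 g2 g3.
have i1n := ltn_ord (high i); rewrite /= in i1n.
have nxy : x <> y by move=> e; apply: ne; rewrite e.
have Tx' : T x = i :> nat by rewrite Tx.
have Ty' : T y = i.+1 :> nat by rewrite Ty.
have [b2 hb2] := g3 i.+2 i1n.
have rx1 : nth 0 b2 (row x) = (col x).+1.
  have h : col x < nth 0 b2 (row x) by apply/hb2; exists x; split=> //; lia.
  apply/eqP; rewrite eqn_leq h andbT leqNgt; apply/negP => /hb2 [b [Tb rb cb]].
  have bx : b <> x by move=> e; move: cb; rewrite e; lia.
  have by_ : b <> y by move=> e; apply: ne; rewrite -rb e.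
  have [] := others bx by_.
  have := g1 x b (esym rb); rewrite cb => /(_ (leqnn _)); lia.
have sx : row x < size b2 by apply: (@peak_size _ b2 _ 0); rewrite rx1.
have lastx : col x <= 1 -> size b2 = (row x).+1.
  move=> cx; apply/eqP; rewrite eqn_leq sx andbT leqNgt; apply/negP => sx1.
  have := peak_gt1 sx1; rewrite rx1 => cx0.
  have /hb2 [z [Tz rz cz]] := peak_gt0 sx1.
  have zx : z <> x by move=> e; move: rz; rewrite e; lia.
  have zy : z <> y by move=> e; move: swap_colxy; rewrite -e cz; lia.
  have Tzi : T z < i by have [] := others zx zy; lia.
  have [|b0 hb0] := g3 i; first lia.
  have z0 : 0 < nth 0 b0 (row x).+1 by apply/hb0; exists z.
  have /hb0 [b [Tb rb cb]] := peak_gt1 (peak_size z0).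
  have e : b = x by apply: dbox_eq => //; lia.
  by move: Tb; rewrite e; lia.
split.
- apply: (@inj_card_bij _ _ (swap i T)); last first.
    by rewrite card_ord; apply: eq_leq; rewrite [RHS]dbox_card.
  by move=> b b'; rewrite !ffunE => /perm_inj /Tinj.
- move=> b b' r c; rewrite !ffunE; apply: tperm_lt; first exact: g1.
  by move=> [e1 e2]; apply: ne; move: r; rewrite (Tinj (etrans e1 (esym Tx)))
    (Tinj (etrans e2 (esym Ty))).
- move=> b b' c c' r; rewrite !ffunE; apply: tperm_lt; first exact: g2.
  move=> [e1 e2]; have e1' := Tinj (etrans e1 (esym Tx)).
  have e2' := Tinj (etrans e2 (esym Ty)); subst b b'.
  have hs : size b2 = (row x).+1 by apply: lastx; lia.
  have h : 0 < nth 0 b2 (row y) by apply/hb2; exists y; split=> //; lia.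
  by have := peak_size h; lia.
move=> k hk; have [ek|/eqP nk] := eqVneq k i.+1; last first.
  have [b hb] := g3 k hk; exists b => r c; rewrite hb; split=> -[z [h1 h2 h3]];
    exists z; split=> //; move: h1; rewrite ffunE tperm_ltk //.
subst k.
pose s := if col x == 0 then take (row x) b2 else set_nth 0 b2 (row x) (col x).
have nths r : nth 0 s r = if r == row x then col x else nth 0 b2 r.
  rewrite /s; case: (eqVneq (col x) 0) => [cx|cx]; last by rewrite nth_set_nth.
  have hs : size b2 = (row x).+1 by apply: lastx; lia.
  case: (ltngtP r (row x)) => hr.
  - by rewrite nth_take.
  - by rewrite !nth_default // ?hs // size_take hs ltnSn ltnW.
  - by rewrite nth_default ?cx // size_take hs ltnSn hr.
have sizes : size s = if col x == 0 then row x else size b2.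
  rewrite /s; case: eqP => cx; first by rewrite size_take sx.
  by rewrite size_set_nth; apply/maxn_idPr.
have s0 : all (leq 1) s.
  apply/(all_nthP 0) => r; rewrite nths sizes; case: (eqVneq (col x) 0) => cx hr.
    by case: eqP => [e|_]; [lia | apply: peak_gt0; lia].
  by case: eqP => [e|_]; [lia | apply: peak_gt0; lia].
have s1 : all (leq 2) (take (size s).-1 s).
  apply/(all_nthP 0) => r; rewrite size_take => hr.
  have {}hr : r.+1 < size s by move: hr; case: ifP; lia.
  rewrite nth_take; last lia.
  rewrite nths; move: hr; rewrite sizes; case: (eqVneq (col x) 0) => cx hr.
    by case: eqP => [e|_]; [lia | apply: peak_gt1; lia].
  case: eqP => [e|_]; last by apply: peak_gt1.
  by case: (ltnP 1 (col x)) => // /lastx; lia.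
have ss : sumn s = i.+1.
  have := parts_sum b2; rewrite /s; case: (eqVneq (col x) 0) => cx.
    have hs : size b2 = (row x).+1 by apply: lastx; lia.
    rewrite -{1}[b2 : seq nat](cat_take_drop (row x)) sumn_cat (drop_nth 0 sx).
    by rewrite rx1 cx drop_oversize ?hs //=; lia.
  by rewrite sumn_set_nth0 rx1; lia.
exists (PeakComp s0 s1 ss) => r c; rewrite /= nths; split.
  move=> h.
  have [hc nrc] : c < nth 0 b2 r /\ ~ (r = row x /\ c = col x).
    by move: h; case: eqP => [->|nr] h; [rewrite rx1|]; split=> //; lia.
  have /hb2 [b [Tb rb cb]] := hc; exists b; split=> //; rewrite ffunE.
  have bx : b <> x by move=> e; apply: nrc; rewrite -rb -cb e.
  have [->|/eqP by_] := eqVneq b y; first by rewrite Ty tpermR /=.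
  have [h1 h2] := others bx by_.
  case: tpermP => [e|e|_ _]; first 1 [by rewrite e in h1]; last lia.
  by rewrite e in h2.
move=> [b [Tb rb cb]]; move: Tb; rewrite ffunE.
have [-> |/eqP bx] := eqVneq b x; first by rewrite Tx tpermL /=; lia.
move=> Tb.
have Tb2 : T b < i.+2.
  have [->|/eqP by_] := eqVneq b y; first lia.
  by move: Tb; case: tpermP => [->|->|_ _] /=; lia.
have hc : c < nth 0 b2 r by apply/hb2; exists b.
case: eqP => // er; move: hc; rewrite er rx1 ltnS leq_eqVlt => /orP [/eqP ec|//].
by case: bx; apply: dbox_eq; lia.
Qed.

Lemma SPCT_attacking : attacking SPCT_set T i = (row x == row y).
Proof.
rewrite /attacking swap_notDes /=; apply/idP/eqP => [h|e].
  by apply: contrapT => /swap_diff_row /SPCTP h'; rewrite h' in h.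
by apply/negP => /SPCTP; apply: swap_same_row.
Qed.

End Swap.

Lemma SPCT_standard T : T \in SPCT_set -> standard T.
Proof. by move=> /SPCTP []. Qed.

Lemma onth_rw (T : filling peak_diagram) r k : onth (rw T) r = Some k ->
  exists2 b : dbox, T b = k & forall b0, nth b0 (reading peak_diagram) r = b /\
    r < size (reading peak_diagram).
Proof.
move=> h; have hr : r < size (reading peak_diagram).
  by rewrite -(size_map T) -onthTE -/(rw T) h.
have b0 : dbox by case: (reading peak_diagram) hr.
exists (nth b0 (reading peak_diagram) r).
  by have := onth_nth (T b0) _ _ _ h; rewrite (nth_map b0).
by move=> b1; split=> //; apply: set_nth_default.
Qed.

Lemma SPCT_compatible : ascent_compatible SPCT_set.
Proof.
move=> T T' i i' r s /SPCTP hT /SPCTP hT' /and3P[rs /eqP Tr /eqP Ts]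
  /and3P[_ /eqP Tr' /eqP Ts'].
have [x Tx hx] := onth_rw Tr; have [y Ty hy] := onth_rw Ts.
have [x' Tx' hx'] := onth_rw Tr'; have [y' Ty' hy'] := onth_rw Ts'.
have ex : x' = x by rewrite -(hx x).1 (hx' x).1.
have ey : y' = y by rewrite -(hy x).1 (hy' x).1.
subst x' y'.
have u : uniq (reading peak_diagram).
  by rewrite (perm_uniq (reading_perm peak_diagram)) enum_uniq.
have xy : index x (reading peak_diagram) < index y (reading peak_diagram).
  have [e1 l1] := hx x; have [e2 l2] := hy x.
  by move: rs; rewrite -{1}(index_uniq x l1 u) -{1}(index_uniq x l2 u) e1 e2.
by rewrite (SPCT_attacking hT Tx Ty xy) (SPCT_attacking hT' Tx' Ty' xy).
Qed.

Definition SPCT : tab_family peak_diagram :=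
  TabFamily SPCT_standard SPCT_compatible.

(* The source tableau, with entries shifted by one: in row r (from 0), the
   first column holds 2r+1 and the second one 2r+2. *)
Definition source_first (b : dbox) : nat :=
  if col b == 0 then (row b).*2 else (row b).*2.+1.

Definition source_remaining : seq nat :=
  [seq k <- iota 0 n |
    k \notin [seq source_first b | b <- reading peak_diagram & col b < 2]].

Definition source_entry (b : dbox) : nat :=
  if col b < 2 then source_first b
  else nth 0 source_remaining
         (index b [seq b' <- reading peak_diagram | 1 < col b']).

Lemma source_entry_lt (b : dbox) : source_entry b < n.
Proof.
have hc : col b < nth 0 alpha (row b) by rewrite /col /row; case: b => r c /=.
have n0 : 0 < n by rewrite -dbox_card; apply/card_gt0P; exists b.
rewrite /source_entry; case: ifP => c2.
  have := peak_bound c2 hc; rewrite /source_first; case: eqP; lia.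
case: (ltnP (index b [seq b' <- reading peak_diagram | 1 < col b'])
            (size source_remaining)) => h; last by rewrite nth_default.
by have := mem_nth 0 h; rewrite mem_filter mem_iota => /andP[_ /andP[_]].
Qed.

Definition source_tableau : filling peak_diagram :=
  [ffun b : dbox => Ordinal (source_entry_lt b)].

End PeakTableaux.

(* Main.v *)
(* A standard filling of D(alpha) is an SPCT exactly when its rows increase and
   the entry in column 2 of each row is below the first entry of the next row.
   If i is a descent of T and s_i T is still an SPCT, then T = pi_i (s_i T);
   undoing such descents terminates at a tableau T0 without any.  In T0,
   consecutive entries i, i+1 follow the reading order, except for steps from
   column 2 to column 1 of the next row.  Hence the columns from the third on
   are never left once entered, which forces T0 to be the source tableau, and
   the pi_i alone already generate the module from it. *)
Require Import Defs.
From mathcomp Require Import all_boot all_order all_algebra.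
From mathcomp Require Import reals complex.
From mathcomp Require Import all_fingroup boolp zify.
Set Implicit Arguments. Unset Strict Implicit. Unset Printing Implicit Defensive.
Import GRing.Theory.
Local Open Scope ring_scope.

(** * Cyclic generators under extension of scalars *)

Lemma tens_scale (A B : pzRingType) (f : {rmorphism A -> B}) (N : lmodType A)
  (b : B) (v : N) : tens f b v = b *: tens f 1 v.
Proof. by rewrite /GRing.scale /= /tens tscaleE /= mulr1. Qed.

Lemma tens_balanced (A B : pzRingType) (f : {rmorphism A -> B}) (N : lmodType A)
  (b : B) (a : A) (v : N) : tens f b (a *: v) = tens f (b * f a) v.
Proof. by apply/tclsP/tcong_sym/tcong_balanced. Qed.

(** On pure tensors, moving [a] across the tensor sign rewrites [b] tensor [a *: u] as [b * f a]
    acting on [1] tensor [u]; sums and opposites follow by adding and negating coefficients. *)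
Lemma Ind_cyclic (A B : pzRingType) (f : {rmorphism A -> B}) (N : lmodType A)
  (u : N) : (forall v : N, exists a : A, v = a *: u) ->
  forall w : Ind f N, exists b : B, w = b *: tens f 1 u.
Proof.
move=> gen; elim/tclsW; elim=> [b v||x [b IH]|x [b IHx] y [c IHy]].
- have [a ->] := gen v; exists (b * f a).
  by rewrite -tens_scale -tens_balanced.
- by exists 0; rewrite scale0r.
- by exists (- b); rewrite scaleNr -IH; exact/esym/toppE.
- by exists (b + c); rewrite tclsD IHx IHy scalerDl.
Qed.

(** * Generation inside a diagram module *)

Section DiagramModuleGeneration.
Variables (n : nat) (D : diagram n) (F : fieldType) (X : tab_family D).

Lemma Des_swap (i : 'I_n.-1) (T : filling D) :
  i \in Des T -> i \notin Des (swap i T).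
Proof.
by rewrite !inE -!/(pos _ _) !pos_swap tpermL tpermR -leqNgt => /ltnW.
Qed.

(** Undoing the descent makes [i] a nonattacking ascent of [swap i T], so the generator at [i]
    exchanges the two entries back. *)
Lemma tab_swap_Des (i : 'I_n.-1) (T : filling D) :
  T \in X -> swap i T \in X -> i \in Des T ->
  (tab F X T : N F X) = pgen (@H0_rel F n) i *: (tab F X (swap i T) : N F X).
Proof.
move=> hT hs di; rewrite rep_genE /= N_step // (negbTE (Des_swap di)).
by rewrite swapK hT.
Qed.

(** Turns the coefficients of a basis expansion into elements of the Hecke algebra, so that one
    algebra element can absorb the whole sum in [N_cyclic]. *)
Lemma N_scalar (a : F) (v : Nspace F X) :
  (a *: v : Nspace F X) = pscal (@H0_rel F n) a *: (v : N F X) :> N F X.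
Proof. by rewrite /GRing.scale [RHS]/= rep_scaleE. Qed.

Lemma N_cyclic (S : filling D) :
  (forall T, T \in X -> exists h : H0 F n,
     (tab F X T : N F X) = h *: (tab F X S : N F X)) ->
  forall v : N F X, exists h : H0 F n, v = h *: (tab F X S : N F X).
Proof.
move=> gen v; rewrite [v]Nspace_sum.
elim/big_ind: _ => [|u w [h hu] [k hw]|U _].
- by exists 0; rewrite scale0r.
- by exists (h + k); rewrite scalerDl -hu -hw.
have [h e] := gen _ (valP U); exists (pscal (@H0_rel F n) (v U) * h).
by rewrite -scalerA -e -N_scalar.
Qed.

Lemma N_cyclic_generated_by (S : filling D) :
  (forall T, T \in X -> exists h : H0 F n,
     (tab F X T : N F X) = h *: (tab F X S : N F X)) -> generated_by F X S.
Proof. by move=> gen; apply: Ind_cyclic; apply: N_cyclic. Qed.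

End DiagramModuleGeneration.

(** * Peak compositions from row lengths *)

Local Open Scope nat_scope.

(** The hypothesis forces the zeros of [s] to form a suffix. Dropping it leaves every [nth 0]
    unchanged, because the default value is 0. *)
Lemma peak_comp_of_seq (s : seq nat) :
  (forall r, 0 < nth 0 s r.+1 -> 1 < nth 0 s r) ->
  exists b : peak_comp (sumn s), forall r, nth 0 b r = nth 0 s r.
Proof.
elim: s => [_|x s IH hs].
  by exists (@PeakComp 0 [::] isT isT erefl).
have [b hb] := IH (fun r => hs r.+1).
have [x0|x0] := posnP x.
  have z r : nth 0 (x :: s) r = 0.
    elim: r => [//|r IHr]; apply/eqP; rewrite -leqn0 leqNgt; apply/negP => /hs.
    by rewrite IHr.
  have s0 : sumn (x :: s) = 0.
    rewrite sumnE big_seq big1 // => k /(nthP 0) [r _ <-]; exact: z.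
  rewrite s0; exists (@PeakComp 0 [::] isT isT erefl) => r.
  by rewrite z nth_nil.
have h0 : all (leq 1) (x :: b) by rewrite /= x0 (parts_gt0 b).
have h1 : all (leq 2) (take (size (x :: b)).-1 (x :: b)).
  case: b hb {h0} => [[|y t] g0 g1 e] /= hb //.
  have y0 : 0 < y by case/andP: g0.
  by rewrite (hs 0) /= -?hb //=; exact: g1.
have hsum : sumn (x :: b) = sumn (x :: s) by rewrite /= (parts_sum b).
by exists (PeakComp h0 h1 hsum) => -[|r] //=.
Qed.

Lemma card_ord_lt (m c : nat) : c <= m -> #|[set j : 'I_m | j < c]| = c.
Proof.
move=> cm; rewrite -sum1dep_card -(big_ord_widen m (fun=> 1) cm).
by rewrite sum1_card card_ord.
Qed.

(** A down-closed set of ordinals is an initial segment, hence determined by its size. This makes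
    the small entries of an increasing row left-justified. *)
Lemma down_closed_card (m : nat) (A : {set 'I_m}) :
  (forall i j : 'I_m, i < j -> j \in A -> i \in A) ->
  forall c : 'I_m, (c < #|A|) = (c \in A).
Proof.
move=> dA c; apply/idP/idP => [|cA]; last first.
  rewrite -(card_ord_lt (ltn_ord c)); apply: subset_leq_card.
  apply/subsetP => j; rewrite inE ltnS leq_eqVlt => /orP[/eqP/val_inj->//|jc].
  exact: dA jc cA.
apply: contraLR => cA; rewrite -leqNgt -[leqRHS](card_ord_lt (ltnW (ltn_ord c))).
apply: subset_leq_card; apply/subsetP => j jA; rewrite inE ltnNge leq_eqVlt.
apply/negP => /orP[/eqP/val_inj e|cj]; first by rewrite e jA in cA.
by rewrite (dA _ _ cj jA) in cA.
Qed.

(** * A termination measure for undoing descents *)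

Section Weight.
Variables (n : nat) (D : diagram n).

Lemma mem_reading (b : box D) : b \in reading D.
Proof. by rewrite (perm_mem (reading_perm D)) mem_enum. Qed.

(** Pairing reading positions with entries favours fillings whose large entries are read late. *)
Definition weight (T : filling D) : nat := \sum_(b : box D) index b (reading D) * T b.

Lemma index_reading_bound (b : box D) : index b (reading D) < n.
Proof.
by rewrite -[X in _ < X](box_card D) cardE -(perm_size (reading_perm D))
  index_mem mem_reading.
Qed.

Lemma weight_bound (T : filling D) : weight T <= n * (n * n).
Proof.
have : weight T <= \sum_(b : box D) n * n.
  apply: leq_sum => b _; apply: leq_mul; apply: ltnW; last exact: ltn_ord.
  exact: index_reading_bound.
by rewrite sum_nat_const box_card.
Qed.

(** Only the terms of the boxes holding [low i] and [high i] change. The larger entry moves to the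
    later position, so the sum grows by the distance between the two positions. *)
Lemma weight_swap_Des (T : filling D) (i : 'I_n.-1) : standard T -> i \in Des T ->
  weight T < weight (swap i T).
Proof.
move=> sT; case: (sT) => g gK Kg; have Tinj := bij_inj sT.
set x := g (low i); set y := g (high i).
have Tx : T x = low i by exact: Kg.
have Ty : T y = high i by exact: Kg.
rewrite inE /rw -Tx -Ty !(index_map Tinj) => lt.
have nyx : y != x by apply: contraTneq lt => ->; rewrite ltnn.
rewrite /weight (bigD1 x) //= (bigD1 y) //= [X in _ < X](bigD1 x) //=.
rewrite [X in _ < _ + X](bigD1 y) //= !ffunE Tx Ty tpermL tpermR /=.
have -> : \sum_(b | (b != x) && (b != y)) index b (reading D) * swap i T b =
  \sum_(b | (b != x) && (b != y)) index b (reading D) * T b.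
  apply: eq_bigr => b /andP[bx by_]; rewrite ffunE tpermD //.
    by rewrite -Tx eq_sym (inj_eq Tinj).
  by rewrite -Ty eq_sym (inj_eq Tinj).
nia.
Qed.

End Weight.

(** * Standard peak tableaux through local inequalities *)

Section PeakTableaux.
Variables (n : nat) (alpha : peak_comp n).
Local Notation D := (peak_diagram alpha).
Local Notation dbox := (dbox alpha).
Local Notation row := (@Defs.row n alpha).
Local Notation col := (@Defs.col n alpha).
Implicit Types (b x y : dbox) (T : filling D).

Definition mkbox (r : 'I_(size alpha)) (c : 'I_(nth 0 alpha r)) : dbox :=
  @existT 'I_(size alpha) (fun r => 'I_(nth 0 alpha r)) r c.

Lemma dbox_reading b : b \in reading D.
Proof. exact: (@mem_reading n D). Qed.

Lemma row_lt b : row b < size alpha. Proof. exact: (ltn_ord (tag b)). Qed.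
Lemma col_lt b : col b < nth 0 alpha (row b). Proof. exact: (ltn_ord (tagged b)). Qed.

Lemma dbox_ex r c : c < nth 0 alpha r -> exists b : dbox, row b = r /\ col b = c.
Proof.
move=> hc; have hr := peak_size hc.
by exists (@mkbox (Ordinal hr) (Ordinal hc)).
Qed.

Definition row_increasing T : Prop :=
  forall b b' : dbox, row b = row b' -> col b < col b' -> T b < T b'.

(** The form that (SPCT3) takes once rows increase; see [SPCT_predE]. Columns count from 0. *)
Definition peak_increasing T : Prop :=
  forall b b' : dbox, col b = 1 -> col b' = 0 -> row b' = (row b).+1 -> T b < T b'.

Lemma injective_standard T : injective T -> standard T.
Proof.
move=> Ti; apply: inj_card_bij => //.
by rewrite card_ord; apply: eq_leq; rewrite [RHS]dbox_card.
Qed.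

(** Climb one row at a time: a row that is not the last has a second box, whose entry lies between
    the first entries of that row and the next. *)
Lemma col0_increasing T : row_increasing T -> peak_increasing T ->
  forall b b' : dbox, col b = 0 -> col b' = 0 -> row b < row b' -> T b < T b'.
Proof.
move=> hr hp b b' cb; move er: (row b') => r.
elim: r b' er => // r IH b' er cb' hlt.
have a1 : 1 < nth 0 alpha r by apply: peak_gt1; rewrite -er row_lt.
have [p [rp cp]] := dbox_ex a1; have [q [rq cq]] := dbox_ex (ltnW a1).
have qp : T q < T p by apply: hr; rewrite ?rq ?rp ?cp ?cq.
have pb' : T p < T b' by apply: hp; rewrite ?rp.
have [e|lt] := eqVneq (row b) r.
  by have -> : b = q; [apply: dbox_eq; lia | lia].
by have := IH q rq cq; lia.
Qed.

Lemma SPCT_predE T :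
  SPCT_pred T <-> [/\ standard T, row_increasing T & peak_increasing T].
Proof.
split=> [[sT hr h0 h3]|[sT hr hp]].
  split=> // b b' cb cb' rb'.
  (* Cut just after the entry of [b']. The row of [b] is then not the last one of the peak
     composition [be], so it already contains its second box, which is [b]. *)
  have [be hbe] := h3 (T b').+1 (ltn_ord (T b')).
  have /peak_size sb : 0 < nth 0 be (row b') by apply/hbe; exists b'.
  rewrite rb' in sb; have /hbe [b2 [Tb2 rb2 cb2]] := peak_gt1 sb.
  have e : b2 = b by apply: dbox_eq; rewrite ?cb.
  move: Tb2; rewrite e ltnS leq_eqVlt => /orP[/eqP/val_inj/(bij_inj sT) e'|//].
  by rewrite e' cb' in cb.
have h0 := col0_increasing hr hp.
split=> // k /andP[k0 kn].
(* [A r] collects the columns of row [r] with entry below [k], and [s] lists the row lengths,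
   possibly ending in zeros. *)
pose A (r : 'I_(size alpha)) : {set 'I_(nth 0 alpha r)} :=
  [set c | T (@mkbox r c) < k].
pose s := [seq #|A r| | r <- enum 'I_(size alpha)].
have ss : sumn s = k.
  rewrite sumnE big_map big_enum /=.
  under eq_bigr => r _ do rewrite -sum1dep_card.
  (* The double sum over rows and columns becomes a sum over boxes, which the bijection [T] carries
     to the [k] values below [k]. *)
  rewrite (sig_big_dep _ (fun (r : 'I_(size alpha)) (c : 'I_(nth 0 alpha r)) =>
    T (@mkbox r c) < k) (fun _ _ => 1)) /=.
  rewrite -[RHS](card_ord_lt kn) -sum1dep_card.
  rewrite [RHS](reindex T) /=; last exact: onW_bij.
  by apply: eq_bigl => -[r c].
have ns (b : dbox) : nth 0 s (row b) = #|A (tag b)|.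
  by rewrite /s (nth_map (tag b)) ?size_enum_ord ?row_lt // nth_ord_enum.
have nsP r c : c < nth 0 s r <-> exists b : dbox, [/\ T b < k, row b = r & col b = c].
  have As (b : dbox) : (col b < nth 0 s (row b)) = (T b < k).
    rewrite ns; case: b => q d; rewrite /col /= down_closed_card ?inE //.
    move=> i j ij; rewrite !inE; apply: ltn_trans.
    by apply: hr.
  split=> [h|[b [Tb <- <-]]]; last by rewrite As.
  have hs : r < size alpha.
    case: (ltnP r (size alpha)) => // g.
    by rewrite nth_default // size_map size_enum_ord in h.
  have hc : c < nth 0 alpha r.
    apply: leq_trans h _.
    rewrite /s (nth_map (Ordinal hs)) ?size_enum_ord //.
    by rewrite (nth_ord_enum _ (Ordinal hs)); apply: leq_trans (max_card _) _;
      rewrite card_ord.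
  by have [b [rb cb]] := dbox_ex hc; exists b; split=> //; rewrite -As rb cb.
have [|be hbe] := @peak_comp_of_seq s.
  move=> r /nsP [b [Tb rb cb]].
  have a1 : 1 < nth 0 alpha r by apply: peak_gt1; rewrite -rb row_lt.
  have [p [rp cp]] := dbox_ex a1; apply/nsP; exists p; split=> //.
  by apply: ltn_trans Tb; apply: hp; rewrite ?rp.
move: be hbe; rewrite ss => be hbe; exists be => r c.
by rewrite hbe; exact: nsP.
Qed.

(** * Nonemptiness: filling the rows one after another *)

Definition row_entry b : nat := sumn (take (row b) alpha) + col b.

Lemma row_entry_lt_row b r : row b < r -> row_entry b < sumn (take r alpha).
Proof.
move=> h; have e : take (row b).+1 alpha = take (row b).+1 (take r alpha).
  by rewrite take_takel.
apply: (@leq_trans (sumn (take (row b).+1 alpha))).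
  by rewrite (take_nth 0) ?row_lt // sumn_rcons ltn_add2l col_lt.
by rewrite e -[in leqRHS](cat_take_drop (row b).+1 (take r alpha)) sumn_cat leq_addr.
Qed.

Lemma row_entry_lt b : row_entry b < n.
Proof. by have := row_entry_lt_row (row_lt b); rewrite take_size parts_sum. Qed.

Definition row_filling : filling D := [ffun b : dbox => Ordinal (row_entry_lt b)].

Lemma row_filling_SPCT : SPCT_pred row_filling.
Proof.
apply/SPCT_predE; split.
- apply: injective_standard => b b'; rewrite !ffunE => /(congr1 val) /= e.
  have [lt|gt|er] := ltngtP (row b) (row b').
  + by have := row_entry_lt_row lt; rewrite e /row_entry; lia.
  + by have := row_entry_lt_row gt; rewrite -e /row_entry; lia.
  + by apply: dbox_eq => //; move: e; rewrite /row_entry er; lia.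
- by move=> b b' er lt; rewrite !ffunE /= /row_entry er ltn_add2l.
- move=> b b' cb cb' er; rewrite !ffunE /= [X in _ < X]/row_entry er.
  by apply: ltn_addr; apply: row_entry_lt_row.
Qed.

(** * The reading order on boxes *)

Lemma reads_before_refl : reflexive (@reads_before n alpha).
Proof. by move=> b; rewrite /reads_before; lia. Qed.

Lemma reads_before_anti : antisymmetric (@reads_before n alpha).
Proof. by move=> x y; rewrite /reads_before => h; apply: dbox_eq; lia. Qed.

Lemma index_reading_lt x y : ~~ reads_before x y ->
  index y (reading D) < index x (reading D).
Proof.
move=> nxy; case: ltngtP => // [lt|e].
  have := sorted_ltn_index (@reads_before_trans n alpha)
    (sort_sorted (@reads_before_total n alpha) (enum dbox)) _ _
    (dbox_reading x) (dbox_reading y) lt.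
  by rewrite (negbTE nxy).
have exy : y = x by rewrite -(nth_index x (dbox_reading y)) e nth_index ?dbox_reading.
by rewrite exy reads_before_refl in nxy.
Qed.

(** * A tableau with no descent that can be undone is the source tableau *)

Section Minimal.
Variable T : filling D.
Hypotheses (hT : SPCT_pred T)
  (minT : forall i : 'I_n.-1, i \in Des T -> ~ SPCT_pred (swap i T)).

Let Tinj : injective T.
Proof. by case: hT => /bij_inj. Qed.

Lemma entry_inj x y : T x = T y :> nat -> x = y.
Proof. by move=> e; apply/Tinj/val_inj. Qed.

Lemma entry_box k : k < n -> exists b : dbox, T b = k :> nat.
Proof.
move=> kn; case: hT => -[g _ gK] _ _ _.
by exists (g (Ordinal kn)); rewrite gK.
Qed.

(** If [y] is read before [x], the two entries form a descent, and by [minT] exchanging them must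
    break an inequality. Only the one between [x] and [y] can break; the row inequality is excluded
    since rows are read from left to right, so the peak inequality remains. *)
Lemma minimal_step x y : T y = (T x).+1 :> nat ->
  reads_before x y \/ [/\ col x = 1, col y = 0 & row y = (row x).+1].
Proof.
move=> exy; have [h|nxy] := boolP (reads_before x y); [by left | right].
have lx : T x < n.-1 by have := ltn_ord (T y); lia.
pose i : 'I_n.-1 := Ordinal lx.
have Tx : T x = low i by apply: val_inj.
have Ty : T y = high i by apply: val_inj.
have di : i \in Des T.
  by rewrite inE /rw -Tx -Ty !(index_map Tinj); apply: index_reading_lt.
case/SPCT_predE: hT => sT hr hp.
have lt b b' : T b < T b' -> ~ (b = x /\ b' = y) -> swap i T b < swap i T b'.
  move=> h nb; rewrite !ffunE; apply: tperm_lt => //.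
  by rewrite -Tx -Ty => -[/Tinj e /Tinj e']; apply: nb.
apply: contrapT => nrel; apply: (minT di); apply/SPCT_predE; split.
- by apply: injective_standard => b b'; rewrite !ffunE => /perm_inj/Tinj.
- move=> b b' er ec; apply: lt; first exact: hr.
  by move=> [eb eb']; move: nxy er ec; rewrite /reads_before eb eb'; lia.
- move=> b b' cb cb' er; apply: lt; first exact: hp.
  by move=> [eb eb']; apply: nrel; rewrite -eb -eb'.
Qed.

(** Follow the consecutive entries from [T x] to [T y]. The exceptional step of [minimal_step]
    starts in column 1, which is never reached again because all boxes met are read after [x]. *)
Lemma minimal_reads_before x y : 1 < col x -> T x <= T y -> reads_before x y.
Proof.
move=> cx; move ek: (T y : nat) => k; elim: k y ek => [|k IH] y ek hxy.
  have -> : y = x by apply: entry_inj; lia.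
  exact: reads_before_refl.
have [e|ne] := eqVneq (T x : nat) k.+1.
  have -> : y = x by apply: entry_inj; lia.
  exact: reads_before_refl.
have [|z hz] := @entry_box k; first by have := ltn_ord (T y); lia.
have xz : reads_before x z by apply: IH; lia.
have [|zy|[cz _ _]] := @minimal_step z y; first by rewrite hz.
  exact: reads_before_trans xz zy.
by move: xz cx cz; rewrite /reads_before; lia.
Qed.

Lemma source_first_increasing x y : col x < 2 -> col y < 2 ->
  source_first x < source_first y -> T x < T y.
Proof.
case/SPCT_predE: hT => sT hr hp cx cy hxy.
have h0 := col0_increasing hr hp.
have [rxy|] := ltnP (row x) (row y); last first.
  move=> ryx; apply: hr; move: hxy; rewrite /source_first; case: eqP; case: eqP; lia.
have a1 : 1 < nth 0 alpha (row x).
  by apply: peak_gt1; apply: leq_ltn_trans (row_lt y).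
have a1' : 0 < nth 0 alpha (row x).+1.
  by apply: peak_gt0; apply: leq_ltn_trans (row_lt y).
have a0 : 0 < nth 0 alpha (row y) by apply: leq_ltn_trans (col_lt y).
(* The chain runs from [x] to the second box [p] of its row, the first box [q] of the next row, the
   first box [z] of the row of [y], and finally [y]. *)
have [p [rp cp]] := dbox_ex a1; have [q [rq cq]] := dbox_ex a1'.
have [z [rz cz]] := dbox_ex a0.
have xp : T x <= T p.
  have [e|ne] := eqVneq (col x) 1; first by rewrite (@dbox_eq _ _ x p) ?rp ?cp.
  by apply: ltnW; apply: hr; lia.
have pq : T p < T q by apply: hp; lia.
have qz : T q <= T z.
  have [e|ne] := eqVneq (row q) (row z); first by rewrite (@dbox_eq _ _ q z) ?cq ?cz.
  by apply: ltnW; apply: h0; lia.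
have zy : T z <= T y.
  have [e|ne] := eqVneq (col y) 0; first by rewrite (@dbox_eq _ _ z y) ?cz.
  by apply: ltnW; apply: hr; lia.
lia.
Qed.

(** The values of [source_first] on the first two columns have no gaps, since every row below
    another one has two boxes. *)
Lemma source_first_pred x : col x < 2 -> 0 < source_first x ->
  exists p : dbox, col p < 2 /\ (source_first p).+1 = source_first x.
Proof.
rewrite /source_first => cx; have [c0|c1] := eqVneq (col x) 0 => h.
  have a1 : 1 < nth 0 alpha (row x).-1.
    by apply: peak_gt1; rewrite prednK ?row_lt //; lia.
  by have [p [rp cp]] := dbox_ex a1; exists p; rewrite rp cp /=; lia.
have a0 : 0 < nth 0 alpha (row x) by apply: leq_ltn_trans (col_lt x).
by have [p [rp cp]] := dbox_ex a0; exists p; rewrite rp cp /=; lia.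
Qed.

Lemma source_first_inj x y : col x < 2 -> col y < 2 ->
  source_first x = source_first y -> x = y.
Proof.
rewrite /source_first => cx cy h; apply: dbox_eq; move: h; case: eqP; case: eqP; lia.
Qed.

Lemma minimal_first x : col x < 2 -> T x = source_first x :> nat.
Proof.
move em: (source_first x) => m; elim/ltn_ind: m x em => m IH x em cx.
have mx : m <= T x.
  have [->//|m0] := posnP m.
  have [|p [cp ep]] := source_first_pred cx; first by rewrite em.
  have Tp : T p = source_first p :> nat by apply: IH => //; lia.
  have : T p < T x by apply: source_first_increasing => //; lia.
  lia.
(* Let [y] hold the value [m]. It cannot lie in a later column, or [x] would be read after it;
   comparing [source_first y] with [m] then leaves only [y = x]. *)
have [y hy] := entry_box (leq_ltn_trans mx (ltn_ord (T x))).
have cy : col y < 2.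
  rewrite ltnNge; apply/negP => cy.
  have : reads_before y x by apply: minimal_reads_before => //; lia.
  by rewrite /reads_before; lia.
have [lt|gt|e] := ltngtP (source_first y) m.
- by have := IH _ lt y erefl cy; lia.
- have : T x < T y by apply: source_first_increasing => //; lia.
  lia.
- by rewrite (@source_first_inj x y) // em.
Qed.

Lemma minimal_later : [seq val (T b) | b : dbox <- reading D & 1 < col b] =
  source_remaining alpha.
Proof.
apply: (irr_sorted_eq ltn_trans ltnn).
- rewrite sorted_map; apply: (sub_in_sorted (P := fun b : dbox => 1 < col b)
    (e := [rel x y | reads_before x y && (x != y)])).
  + move=> x y cx cy /andP[xy nxy]; rewrite /relpre /= ltnNge; apply/negP => yx.
    have yx' : reads_before y x by apply: minimal_reads_before.
    by case/eqP: nxy; apply: reads_before_anti; rewrite xy.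
  + by apply/allP => b; rewrite mem_filter => /andP[].
  (* The strict reading order splits into sortedness and absence of repetitions. *)
  + apply: pairwise_sorted; rewrite pairwise_relI -uniq_pairwise.
    rewrite -sorted_pairwise; last exact: reads_before_trans.
    rewrite filter_uniq ?(perm_uniq (reading_perm D)) ?enum_uniq // andbT.
    apply: sorted_filter; first exact: reads_before_trans.
    exact: sort_sorted (@reads_before_total n alpha) _.
- by apply: sorted_filter; [exact: ltn_trans | exact: iota_ltn_sorted].
move=> k; rewrite mem_filter mem_iota /=; apply/mapP/andP.
  move=> [b]; rewrite mem_filter => /andP[cb _] ->; split; last exact: ltn_ord.
  apply/mapP => -[b']; rewrite mem_filter => /andP[cb' _].
  rewrite -minimal_first // => /val_inj/Tinj e; rewrite e in cb; lia.
move=> [nk kn]; have [b hb] := entry_box kn; exists b => //.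
rewrite mem_filter dbox_reading andbT ltnNge; apply: contra nk => cb.
apply/mapP; exists b; last by rewrite -hb minimal_first.
by rewrite mem_filter dbox_reading andbT.
Qed.

Lemma minimal_source : T = source_tableau alpha.
Proof.
apply/ffunP => b; apply: val_inj; rewrite ffunE /= /source_entry.
case: ifP => cb; first exact: minimal_first.
have hb : b \in [seq b' : dbox <- reading D | 1 < col b'].
  by rewrite mem_filter dbox_reading andbT; lia.
by rewrite -minimal_later (nth_map b) ?index_mem // nth_index.
Qed.

End Minimal.

(** * Descent to the source tableau *)

(** Strong induction on the gap between the weight and its bound. That the source tableau is an SPCT
    is part of the conclusion: it is identified as the tableau at which the undoing of descents
    stops. *)
Lemma SPCT_generated (F : fieldType) T : T \in SPCT alpha ->
  source_tableau alpha \in tabs (SPCT alpha) /\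
  exists h : H0 F n, (tab F (SPCT alpha) T : N F (SPCT alpha)) =
    h *: (tab F (SPCT alpha) (source_tableau alpha) : N F (SPCT alpha)).
Proof.
move em: (n * (n * n) - weight T) => m; elim/ltn_ind: m T em => m IH T em hT.
have pT : SPCT_pred T by apply/SPCTP.
have [[i di hs]|nex] := pselect (exists2 i, i \in Des T & swap i T \in SPCT alpha).
  have lt := weight_swap_Des (SPCT_standard hT) di.
  have [|src [h e]] := IH (n * (n * n) - weight (swap i T)) _ (swap i T) erefl hs.
    by have := weight_bound (swap i T); lia.
  split=> //; exists (pgen (@H0_rel F n) i * h)%R.
  by rewrite (tab_swap_Des F hT hs di) e scalerA.
have e : T = source_tableau alpha.
  apply: minimal_source => // i di hs; apply: nex; exists i => //.
  exact/SPCTP.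
by rewrite -e; split=> //; exists 1%R; rewrite scale1r.
Qed.

End PeakTableaux.

Theorem theorem4p11 (R : realType) (n : nat) (alpha : peak_comp n) :
  tableau_cyclic (complex R) (SPCT alpha) /\
  (source_tableau alpha \in tabs (SPCT alpha) /\
   generated_by (complex R) (SPCT alpha) (source_tableau alpha)).
Proof.
have hrow : row_filling alpha \in SPCT alpha.
  by apply/SPCTP; exact: row_filling_SPCT.
(* Starting the descent from the row filling shows that the source tableau belongs to the family. *)
have [src _] := SPCT_generated (complex R) hrow.
have gen : generated_by (complex R) (SPCT alpha) (source_tableau alpha).
  by apply: N_cyclic_generated_by => T /(SPCT_generated (complex R)) [].
by split; [exists (source_tableau alpha) | split].
Qed.
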